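(* Fix constants $f>0$ and $0<g<1/2$. There exist functions $\varepsilon(n)=\varepsilon_{f,g}(n)$ and $\delta(n)=\delta_{f,g}(n)$ with $\varepsilon(n)\to 0$ and $\delta(n)\to 0$ as $n\to\infty$ such that the following holds for every $n$ and every label set $X$ with $|X|=n$. Let $\mathcal{T}_1$ be any binary phylogenetic $X$-tree equipped with any CFN transition mechanism $\mathcal{P}_1$ satisfying $p_e\le g$ for every edge $e$ of $\mathcal{T}_1$. Then at least $(1-\delta(n))(2n-5)!!$ of the $(2n-5)!!$ binary phylogenetic $X$-trees $\mathcal{T}_2$ have the following property: for every CFN transition mechanism $\mathcal{P}_2$ on $\mathcal{T}_2$ with $p_e\ge f$ for every edge $e$ of $\mathcal{T}_2$, $$\mathrm{vardist}((\mathcal{T}_1,\mathcal{P}_1),(\mathcal{T}_2,\mathcal{P}_2))\ge 2-\varepsilon(n).$$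
   Context: A phylogenetic $X$-tree is a finite tree whose leaves (degree-1 vertices) are bijectively labelled by the elements of $X$; two phylogenetic $X$-trees are identical if there is a graph isomorphism between them that restricts to the identity on $X$. It is binary if every vertex has degree 1 or 3; for $|X|=n$ there are $(2n-5)!!$ distinct binary phylogenetic $X$-trees. CFN model: a transition mechanism $\mathcal{P}$ on a tree $\mathcal{T}$ assigns to each edge $e$ a number $p_e$ with $0<p_e<1/2$. Let $\xi_e$ be independent indicator variables with $\mathbb{P}[\xi_e=1]=p_e$, fix a vertex $v$, give $v$ state $0$ or $1$ with probability $1/2$ each (independently of the $\xi_e$), and for each vertex $u$ set $\mathrm{state}(u)=\mathrm{state}(v)+\sum_{e\in\mathrm{path}(u,v)}\xi_e \pmod 2$, where $\mathrm{path}(u,v)$ is the set of edges on the unique $u$–$v$ path. The restriction to the leaves gives a random pattern $\chi:X\to\{0,1\}$; write $(\mathcal{P})_\chi$ for its probability (this distribution does not depend on the choice of $v$). The variational distance is $\mathrm{vardist}((\mathcal{T}_1,\mathcal{P}_1),(\mathcal{T}_2,\mathcal{P}_2))=\sum_{\chi:X\to\{0,1\}}|(\mathcal{P}_1)_\chi-(\mathcal{P}_2)_\chi|$. *)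

(* Defs.v *)
From HB Require Import structures.
From mathcomp Require Import all_boot all_order all_algebra.
From mathcomp Require Import all_classical all_reals all_analysis.
Set Implicit Arguments. Unset Strict Implicit. Unset Printing Implicit Defensive.
Import Order.TTheory GRing.Theory Num.Theory.
Local Open Scope ring_scope.

Record ptree (X : finType) := PTree {
  vn : nat;
  adj : rel 'I_vn;
  lab : X -> 'I_vn }.
Arguments vn {X} p.
Arguments adj {X} p _ _.
Arguments lab {X} p _.

Definition degree (X : finType) (T : ptree X) (v : 'I_(vn T)) : nat :=
  #|[set w | adj T v w]|.

Definition nedges (X : finType) (T : ptree X) : nat :=
  #|[set e : 'I_(vn T) * 'I_(vn T) | adj T e.1 e.2 && (e.1 < e.2)%N]|.

Definition is_tree (X : finType) (T : ptree X) : Prop :=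
  [/\ symmetric (adj T), irreflexive (adj T), (0 < vn T)%N,
      (forall u v : 'I_(vn T), connect (adj T) u v)
    & nedges T = (vn T).-1].

Definition is_phylo_tree (X : finType) (T : ptree X) : Prop :=
  [/\ is_tree T, injective (lab T)
    & forall v : 'I_(vn T), degree v = 1%N <-> exists x, lab T x = v].

Definition is_binary_phylo_tree (X : finType) (T : ptree X) : Prop :=
  is_phylo_tree T /\ forall v : 'I_(vn T), degree v = 1%N \/ degree v = 3%N.

(* Identity of phylogenetic X-trees: a graph isomorphism restricting to the
   identity on X. *)
Definition ptree_iso (X : finType) (T1 T2 : ptree X) : Prop :=
  exists phi : 'I_(vn T1) -> 'I_(vn T2),
    [/\ bijective phi,
        (forall u v, adj T2 (phi u) (phi v) = adj T1 u v)
      & forall x, phi (lab T1 x) = lab T2 x].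

(* (2n-5)!! = 1 * 3 * ... * (2n-5)  (empty product = 1 for n <= 2) *)
Definition tree_count (n : nat) : nat := \prod_(1 <= k < n.-1) (2 * k - 1).

(* A transition mechanism: p u w is the value p_e on the edge e = {u,w}.
   It must satisfy 0 < p_e < 1/2 on every edge (and be symmetric). *)
Definition cfn_mech (R : realType) (X : finType) (T : ptree X)
  (p : 'I_(vn T) -> 'I_(vn T) -> R) : Prop :=
  forall u w, adj T u w -> 0 < p u w /\ p u w < 2^-1 /\ p u w = p w u.

Definition cfn_prob (R : realType) (X : finType) (T : ptree X)
  (p : 'I_(vn T) -> 'I_(vn T) -> R) (chi : {ffun X -> bool}) : R :=
  \sum_(s : {ffun 'I_(vn T) -> bool} | [forall x, s (lab T x) == chi x])
     2^-1 * \prod_(u : 'I_(vn T))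
              \prod_(w : 'I_(vn T) | adj T u w && (u < w)%N)
                 (if s u == s w then 1 - p u w else p u w).

Definition vardist (R : realType) (X : finType) (T1 T2 : ptree X)
  (p1 : 'I_(vn T1) -> 'I_(vn T1) -> R) (p2 : 'I_(vn T2) -> 'I_(vn T2) -> R) : R :=
  \sum_(chi : {ffun X -> bool}) `|cfn_prob p1 chi - cfn_prob p2 chi|.

(* Main.v *)
Require Import Defs.
From HB Require Import structures.
From mathcomp Require Import all_boot all_order all_algebra all_fingroup.
From mathcomp Require Import all_classical all_reals all_analysis.
(* Restores the finite-set names shadowed by those of [classical_sets]. *)
From mathcomp Require Import fintype finset.
From mathcomp Require Import ring lra zify.
Set Implicit Arguments. Unset Strict Implicit. Unset Printing Implicit Defensive.
Import Order.TTheory GRing.Theory Num.Theory.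
Local Open Scope ring_scope.

(** In any binary tree [T1] with [n] leaves one finds at least [n / C] pairwise
    edge-disjoint paths of length at most 4 joining pairs of leaves [(x, y)].  Writing the
    states as signs, let [S] be the sum of the products of the signs of [x] and [y] over
    these [m] pairs.  Under [T1] the summands are pairwise independent with mean at least
    [(1 - 2 g) ^ 4], so [S] concentrates around a multiple of [m].  Under a tree [T2] the
    product of the signs of four leaves has mean the product of [1 - 2 p_e] over the edge
    set whose odd-degree vertices are these leaves; this is small unless two of the leaves
    are close in [T2].  By symmetry under relabelling, two given leaves are within distance
    [K] in a fraction at most [4 ^ K / (n - 1)] of all trees, so for most [T2] the second
    moment of [S] is [o(m ^ 2)] and Chebyshev's inequality separates the two laws.  We take
    [K = log_64 n].  Only the lower bound [(2 n - 5)!!] on the number of trees is needed;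
    it comes from attaching leaves to edges of trees without nontrivial automorphisms. *)

(** * Walks and cuts *)

Lemma leq_card_bigcup (I V : finType) (P : pred I) (B : I -> {set V}) :
  (#|\bigcup_(i | P i) B i| <= \sum_(i | P i) #|B i|)%N.
Proof.
elim/big_rec2: _ => [|i n A _ le_An]; first by rewrite cards0.
by apply: leq_trans (leq_card_setU _ _) _; rewrite leq_add2l.
Qed.

Section Reach.
Variables (V : finType) (a : rel V).

Fixpoint reach (k : nat) (u v : V) : bool :=
  if k is k'.+1 then [exists z, ((u == z) || a u z) && reach k' z v] else u == v.

Lemma reach_refl k u : reach k u u.
Proof. by elim: k => //= k IH; apply/existsP; exists u; rewrite eqxx. Qed.

Lemma reach_cons k u z v : a u z -> reach k z v -> reach k.+1 u v.
Proof. by move=> uz zv /=; apply/existsP; exists z; rewrite uz orbT. Qed.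

Lemma reach_trans k l u v w : reach k u v -> reach l v w -> reach (k + l) u w.
Proof.
elim: k u => [|k IH] u; first by move=> /eqP ->.
move=> /existsP[z /andP[uz zv]] vw; rewrite addSn; apply/existsP; exists z.
by rewrite uz /=; apply: IH.
Qed.

Lemma reach_leq k l u v : (k <= l)%N -> reach k u v -> reach l u v.
Proof. by move=> /subnK <- uv; apply: reach_trans (reach_refl _ u) uv. Qed.

Lemma reach_adj u v : a u v -> reach 1 u v.
Proof. by move=> uv; apply: reach_cons uv (reach_refl 0 v). Qed.

Lemma reach_sym k u v : symmetric a -> reach k u v -> reach k v u.
Proof.
move=> sa; elim: k u => [|k IH] u; first by move=> /eqP ->; apply: reach_refl.
move=> /existsP[z /andP[uz zv]]; rewrite -addn1.
apply: reach_trans (IH _ zv) _; case/orP: uz => [/eqP-> | uz].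
  exact: reach_refl.
by apply: reach_adj; rewrite sa.
Qed.

Lemma connect_reach u v : connect a u v -> exists k, reach k u v.
Proof.
case/connectP => p; elim: p u => [|z p IH] u /=.
  by move=> _ ->; exists 0%N; apply: reach_refl.
case/andP => uz zp e; case: (IH _ zp e) => k zv.
by exists k.+1; apply: reach_cons uz zv.
Qed.

Lemma card_reach d k u :
  (forall v, (#|[set w | a v w]| <= d)%N) -> (#|[set v | reach k u v]| <= d.+1 ^ k)%N.
Proof.
move=> da; elim: k u => [|k IH] u.
  have -> : [set v | reach 0 u v] = [set u] by apply/setP => v; rewrite !inE eq_sym.
  by rewrite cards1.
have sub : [set v | reach k.+1 u v] \subset
    \bigcup_(z in u |: [set w | a u w]) [set v | reach k z v].
  apply/subsetP => v; rewrite inE => /existsP[z /andP[uz zv]].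
  by apply/bigcupP; exists z; rewrite !inE // eq_sym.
apply: leq_trans (subset_leq_card sub) _.
apply: leq_trans (leq_card_bigcup _ _) _.
apply: (@leq_trans (\sum_(z in u |: [set w | a u w]) d.+1 ^ k)%N); first exact: leq_sum.
rewrite sum_nat_const expnS leq_mul2r; apply/orP; right.
rewrite cardsU1; have := da u; case: (_ \notin _) => /=; lia.
Qed.

End Reach.

Lemma reach_iso (V W : finType) (a : rel V) (b : rel W) (phi : V -> W) k u v :
  (forall u v, a u v -> b (phi u) (phi v)) -> reach a k u v -> reach b k (phi u) (phi v).
Proof.
move=> ab; elim: k u => [|k IH] u; first by move=> /= /eqP ->.
move=> /existsP[z /andP[uz zv]]; apply/existsP; exists (phi z).
apply/andP; split; last exact: IH zv.
by case/orP: uz => [/eqP -> | /ab ->]; rewrite ?eqxx ?orbT.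
Qed.

Section Cuts.
Variable V : finType.
Implicit Types (F G : {set V * V}) (s : V -> bool).

Definition cut F s : bool := \big[addb/false]_(e in F) (s e.1 (+) s e.2).

Lemma cutE F s : cut F s = \big[addb/false]_e ((e \in F) && (s e.1 (+) s e.2)).
Proof. by rewrite /cut big_mkcond; apply: eq_bigr => e _; case: (_ \in _). Qed.

Definition symdiff F G : {set V * V} := [set e | (e \in F) (+) (e \in G)].

Lemma cut_symdiff F G s : cut (symdiff F G) s = cut F s (+) cut G s.
Proof.
rewrite !cutE -big_split /=; apply: eq_bigr => e _; rewrite inE.
by case: (_ \in F); case: (_ \in G); case: (s e.1); case: (s e.2).
Qed.

Lemma cut1 e s : cut [set e] s = s e.1 (+) s e.2.
Proof. by rewrite /cut big_set1. Qed.

Lemma symdiff_sub F G (E : {set V * V}) : F \subset E -> G \subset E -> symdiff F G \subset E.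
Proof.
move=> /subsetP FE /subsetP GE; apply/subsetP => e; rewrite inE.
by case: (boolP (e \in F)) => [/FE // | _]; case: (boolP (e \in G)) => [/GE|].
Qed.

Lemma card_symdiff F G : (#|symdiff F G| <= #|F| + #|G|)%N.
Proof.
apply: leq_trans (leq_card_setU F G); apply/subset_leq_card/subsetP => e.
by rewrite !inE; case: (e \in F); case: (e \in G).
Qed.

Lemma cutD1 F e s : e \in F -> cut (F :\ e) s = cut F s (+) (s e.1 (+) s e.2).
Proof.
move=> eF; rewrite /cut (big_setD1 e eF) /=.
by rewrite addbC addbA addbb addFb.
Qed.

(* [cut F] being the parity on [A] says that [A] is the set of vertices of odd degree in [F]. *)
Lemma cut_reach (a : rel V) k F (A : {set V}) v :
  symmetric a -> irreflexive a -> {in F, forall e, a e.1 e.2} -> (#|F| <= k)%N ->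
  (forall s, cut F s = \big[addb/false]_(u in A) s u) -> v \in A ->
  exists w, [/\ w \in A, w != v & reach a k v w].
Proof.
move=> sa ia; elim: k F A v => [|k IH] F A v Fa Fk FA vA.
  move: Fk; rewrite leqn0 cards_eq0 => /eqP F0; have := FA (pred1 v).
  rewrite F0 /cut big_set0 (bigD1 v) //= eqxx big1 // => u /andP[_ /negPf] //.
have [[e eF ve]|no] := pselect (exists2 e, e \in F & (v == e.1) || (v == e.2)); last first.
  have := FA (pred1 v); rewrite (bigD1 v) //= eqxx [X in _ (+) X]big1; last first.
    by move=> u /andP[_ /negPf].
  rewrite /cut big1 // => e eF /=; have [h|] := boolP ((v == e.1) || (v == e.2)).
    by case: no; exists e.
  by rewrite negb_or !(eq_sym v) => /andP[/negPf-> /negPf->].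
have ae := Fa _ eF.
have [z [az sz]] : exists z, a v z /\ forall s, s e.1 (+) s e.2 = s v (+) s z.
  case/orP: ve => /eqP ->; first by exists e.2.
  by exists e.1; rewrite sa; split=> // s; rewrite addbC.
have zv : z != v by apply: contraTneq az => ->; rewrite ia.
have [zA|zA] := boolP (z \in A).
  by exists z; split=> //; apply: reach_leq (reach_adj az).
have Fk' : (#|F :\ e| <= k)%N by rewrite (cardsD1 e) eF in Fk.
have Fa' : {in F :\ e, forall e, a e.1 e.2} by move=> e' /setD1P[_ /Fa].
have zvA : z \notin A :\ v by rewrite !inE (negPf zA) andbF.
have FA' s : cut (F :\ e) s = \big[addb/false]_(u in z |: (A :\ v)) s u.
  rewrite cutD1 // FA sz big_setU1 //= (big_setD1 v vA) /=.
  by case: (s v); case: (s z); case: (\big[_/_]_(_ in _) _).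
have [w [wA wz zw]] := IH _ _ _ Fa' Fk' FA' (setU11 z _).
exists w; move: wA; rewrite !inE (negPf wz) /= => /andP[wv wA].
by split=> //; apply: reach_cons az zw.
Qed.
End Cuts.

(** * Edges and moments *)

Section Edges.
Variables (X : finType) (T : ptree X).
Local Notation V := 'I_(vn T).

Definition edges : {set V * V} := [set e | adj T e.1 e.2 && (e.1 < e.2)%N].

Lemma edges_adj e : e \in edges -> adj T e.1 e.2.
Proof. by rewrite inE => /andP[]. Qed.

Lemma adj_edge u v : symmetric (adj T) -> irreflexive (adj T) -> adj T u v ->
  exists e, [/\ e \in edges, (e == (u, v)) || (e == (v, u)) &
    forall s : V -> bool, s e.1 (+) s e.2 = s u (+) s v].
Proof.
move=> sa ia uv; have [uv'|vu|/val_inj euv] := ltngtP u v.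
- by exists (u, v); rewrite inE /= uv uv' eqxx.
- by exists (v, u); rewrite inE /= sa uv vu eqxx orbT; split=> // s; rewrite addbC.
- by rewrite euv ia in uv.
Qed.

Lemma reach_edges k u v : symmetric (adj T) -> irreflexive (adj T) ->
  reach (adj T) k u v ->
  exists F : {set V * V},
    [/\ F \subset edges, (#|F| <= k)%N, {in F, forall e, reach (adj T) k u e.1} &
      forall s, cut F s = s u (+) s v].
Proof.
move=> sa ia; elim: k u => [|k IH] u.
  move=> /eqP <-; exists set0; split=> [|||s]; rewrite ?sub0set ?cards0 //.
    by move=> e; rewrite inE.
  by rewrite /cut big_set0 addbb.
move=> /existsP[z /andP[uz zv]]; have [F [FE Fk Fr Fc]] := IH _ zv.
case/orP: uz => [/eqP uz | uz].
  exists F; split=> //; [exact: leq_trans Fk _ | | by rewrite uz].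
  by move=> e /Fr; rewrite uz; apply: reach_leq.
have [e [eE euv ec]] := adj_edge sa ia uz.
exists (symdiff [set e] F); split.
- by apply: symdiff_sub; rewrite ?sub1set.
- by apply: leq_trans (card_symdiff _ _) _; rewrite cards1.
- move=> e'; rewrite !inE; have [->|_] := eqVneq e' e => [_|/Fr]; last exact: reach_cons.
  case/orP: euv => /eqP ->; first exact: reach_refl.
  by apply: reach_leq (reach_adj uz).
- by move=> s; rewrite cut_symdiff cut1 ec Fc; case: (s u); case: (s z); case: (s v).
Qed.

Lemma big_edges (R : Type) (idx : R) (op : Monoid.com_law idx) (h : V -> V -> R) :
  \big[op/idx]_u \big[op/idx]_(w | adj T u w && (u < w)%N) h u w =
  \big[op/idx]_(e in edges) h e.1 e.2.
Proof. by rewrite pair_big_dep /=; apply: eq_bigl => e; rewrite inE. Qed.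

(* A state function on a tree is the same as a root state and arbitrary edge
   increments: [s] is determined by them, and both sides have [2 ^ vn T] elements. *)
Lemma tree_sum_prod (R : comNzRingType) (h : V * V -> bool -> R) : is_tree T ->
  \sum_(s : {ffun V -> bool}) \prod_(e in edges) h e (s e.1 (+) s e.2) =
  2 * \prod_(e in edges) (h e false + h e true).
Proof.
case=> sa ia n0 conn nE.
pose r : V := Ordinal n0.
pose B := setX [set: bool] [set x : {ffun V * V -> bool} | x \in pffun_on false (mem edges) predT].
pose psi (s : {ffun V -> bool}) : bool * {ffun V * V -> bool} :=
  (s r, [ffun e => (e \in edges) && (s e.1 (+) s e.2)]).
have inj : injective psi.
  move=> s t [rst /ffunP est].
  have step u v : adj T u v -> s u (+) s v = t u (+) t v.
    move=> uv; have [e [eE _ ec]] := adj_edge sa ia uv.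
    by have := est e; rewrite !ffunE eE /= !ec.
  apply/ffunP => v; have [p rp ->] := connectP (conn r v).
  elim: p (r) rst rp => [|w p IH] u //= suv /andP[uw wp]; apply: IH => //.
  by move: (step _ _ uw); rewrite suv; case: (t u) => /=; case: (s w); case: (t w).
have psiB : psi @: [set: {ffun V -> bool}] = B.
  apply/eqP; rewrite eqEcard; apply/andP; split.
    apply/subsetP => _ /imsetP[s _ ->]; rewrite !inE /=.
    apply/pffun_onP; split=> //; apply/subsetP => e.
    by apply: contraLR => /negPf eE; rewrite inE ffunE [e \in edges]eE.
  rewrite (card_imset _ inj) cardsX !cardsT cardsE card_bool card_pffun_on.
  rewrite card_ffun !card_bool card_ord.
  have -> : #|mem edges| = (vn T).-1 by rewrite -nE.
  by rewrite -expnS prednK.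
transitivity (\sum_(x in B) \prod_(e in edges) h e (x.2 e)).
  rewrite -psiB big_imset /=; last by move=> s t _ _ /inj.
  rewrite [RHS]big_mkcond /=; apply: eq_bigr => s _; rewrite inE.
  by apply: eq_bigr => e eE; rewrite ffunE eE.
rewrite (eq_bigl (fun x => true && (x.2 \in pffun_on false (mem edges) predT))); last first.
  by move=> x; rewrite !inE.
rewrite -(pair_big xpredT (fun y => y \in pffun_on false (mem edges) predT)
            (fun _ y => \prod_(e in edges) h e (y e))) /=.
rewrite sumr_const card_bool -[LHS]mulr_natl; congr (_ * _).
rewrite -(big_distr_big false (mem edges) predT) /=; apply: eq_bigr => e _.
by rewrite big_bool addrC.
Qed.

End Edges.

Arguments edges {X} T.

Section Moments.
Variables (R : realType) (X : finType) (T : ptree X) (p : 'I_(vn T) -> 'I_(vn T) -> R).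
Local Notation V := 'I_(vn T).

Lemma cfn_prob_ge0 chi : cfn_mech p -> 0 <= cfn_prob p chi.
Proof.
move=> mp; apply: sumr_ge0 => s _; apply: mulr_ge0; first by lra.
apply: prodr_ge0 => u _; apply: prodr_ge0 => w /andP[uw _].
by have [? [? _]] := mp _ _ uw; case: ifP => _; lra.
Qed.

Lemma cfn_moment (F : {set V * V}) (t : {ffun X -> bool} -> bool) :
  is_tree T -> F \subset edges T ->
  (forall s : {ffun V -> bool}, cut F s = t [ffun x => s (lab T x)]) ->
  \sum_chi cfn_prob p chi * (-1) ^+ t chi = \prod_(e in F) (1 - 2 * p e.1 e.2).
Proof.
move=> Tt FE Ft.
pose h (e : V * V) (b : bool) : R :=
  (if b then p e.1 e.2 else 1 - p e.1 e.2) * (if e \in F then (-1) ^+ b else 1).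
transitivity (\sum_(s : {ffun V -> bool}) 2^-1 * \prod_(e in edges T) h e (s e.1 (+) s e.2)).
  rewrite [RHS](partition_big (fun s : {ffun V -> bool} => [ffun x => s (lab T x)]) xpredT) //=.
  apply: eq_bigr => chi _; rewrite /cfn_prob big_distrl /=.
  apply: eq_big => s.
    apply/forallP/eqP => [sc|<- x]; last by rewrite ffunE.
    by apply/ffunP => x; rewrite ffunE; apply/eqP.
  move=> sc; have -> : chi = [ffun x => s (lab T x)].
    by apply/ffunP => x; rewrite ffunE; apply/esym/eqP/(forallP sc).
  rewrite -Ft -mulrA big_edges /h big_split /=; congr (_ * (_ * _)).
    by apply: eq_bigr => e _; case: (s e.1); case: (s e.2).
  rewrite /cut (big_morph (fun b : bool => (-1) ^+ b : R) (@signr_addb R) (erefl _)).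
  rewrite -big_mkcondr /=; apply: eq_bigl => e.
  by case: (boolP (e \in F)) => [/(subsetP FE) ->|]; rewrite ?andbF.
rewrite -mulr_sumr (tree_sum_prod h Tt) mulrA mulVf ?mul1r ?pnatr_eq0 //.
rewrite (bigID (mem F)) /= [X in _ * X]big1 ?mulr1; last first.
  by move=> e /andP[_ /negPf eF]; rewrite /h eF !mulr1 subrK.
apply: eq_big => e.
  by case: (boolP (e \in F)) => [/(subsetP FE) ->|]; rewrite ?andbF.
by move=> /andP[_ eF]; rewrite /h eF expr0 expr1; ring.
Qed.

Lemma cfn_prob_sum1 : is_tree T -> \sum_chi cfn_prob p chi = 1.
Proof.
move=> Tt; have := @cfn_moment set0 (fun=> false) Tt (sub0set _) (fun s => big_set0 _ _ _).
by rewrite big_set0 => <-; apply: eq_bigr => chi _; rewrite expr0 mulr1.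
Qed.

End Moments.

(** * Disjoint short paths in a binary tree *)

Lemma maximum_independent_set (P : finType) (r : rel P) (A : {set P}) : symmetric r ->
  exists I : {set P}, [/\ I \subset A,
    {in I &, forall p q, p != q -> ~~ r p q},
    forall p, p \in A -> exists2 q, q \in I & (p == q) || r p q &
    forall J : {set P}, J \subset A -> {in J &, forall p q, p != q -> ~~ r p q} ->
      (#|J| <= #|I|)%N].
Proof.
move=> sr.
pose ind (I : {set P}) := (I \subset A) &&
  [forall p in I, forall q in I, (p != q) ==> ~~ r p q].
have indP (I : {set P}) : reflect (I \subset A /\ {in I &, forall p q, p != q -> ~~ r p q}) (ind I).
  apply: (iffP andP) => -[IA h]; split=> //.
    by move=> p q pI qI; move/forall_inP: h => /(_ p pI) /forall_inP /(_ q qI) /implyP.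
  by apply/forall_inP => p pI; apply/forall_inP => q qI; apply/implyP; apply: h.
have ind0 : ind set0 by apply/indP; rewrite sub0set; split=> // p; rewrite inE.
case: (@arg_maxnP _ set0 ind (fun I : {set P} => #|I|) ind0) => I indI maxI.
have [IA Ir] := indP _ indI.
exists I; split=> // [p pA|J JA Jr]; last by apply: maxI; apply/indP.
have [[q qI pq]|no] := pselect (exists2 q, q \in I & (p == q) || r p q); first by exists q.
have pI : p \notin I by apply/negP => pI; apply: no; exists p; rewrite ?eqxx.
have pr q : q \in I -> ~~ r p q.
  by move=> qI; apply/negP => pq; apply: no; exists q; rewrite ?pq ?orbT.
suff /maxI : ind (p |: I) by rewrite /= cardsU1 pI add1n ltnn.
apply/indP; split.
  by rewrite subUset sub1set pA.
move=> x y /setU1P[->|xI] /setU1P[->|yI] xy.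
- by rewrite eqxx in xy.
- exact: pr.
- by rewrite sr; apply: pr.
- exact: Ir.
Qed.

Lemma card_dominated (P : finType) (r : rel P) (A I : {set P}) (C : nat) :
  (forall p, p \in A -> exists2 q, q \in I & (p == q) || r p q) ->
  (forall q, q \in I -> (#|[set p in A | (p == q) || r p q]| <= C)%N) ->
  (#|A| <= C * #|I|)%N.
Proof.
move=> dom le; have sub : A \subset \bigcup_(q in I) [set p in A | (p == q) || r p q].
  apply/subsetP => p pA; have [q qI pq] := dom p pA.
  by apply/bigcupP; exists q => //; rewrite inE pA.
apply: leq_trans (subset_leq_card sub) _; apply: leq_trans (leq_card_bigcup _ _) _.
by rewrite mulnC -sum_nat_const; apply: leq_sum.
Qed.

Section BinaryTrees.
Variables (X : finType) (T : ptree X).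
Hypothesis bT : is_binary_phylo_tree T.
Local Notation V := 'I_(vn T).

Lemma binary_tree : is_tree T. Proof. by case: bT => -[]. Qed.

Lemma lab_inj : injective (lab T). Proof. by case: bT => -[]. Qed.

Lemma adj_symmetric : symmetric (adj T). Proof. by case: binary_tree. Qed.

Lemma adj_irreflexive : irreflexive (adj T). Proof. by case: binary_tree. Qed.

Lemma degree_leaf x : degree (lab T x) = 1%N.
Proof. by case: bT => -[_ _ h] _; apply/h; exists x. Qed.

Lemma card_label_reach k x : (#|[set y | reach (adj T) k (lab T x) (lab T y)]| <= 4 ^ k)%N.
Proof.
rewrite -(card_imset _ lab_inj).
apply: leq_trans (card_reach (a := adj T) (d := 3) k (lab T x) _); last first.
  by move=> v; have [_ /(_ v)] := bT; rewrite /degree; case=> ->.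
by apply/subset_leq_card/subsetP => _ /imsetP[y yr ->]; move: yr; rewrite !inE.
Qed.

End BinaryTrees.

Lemma sum_degree (X : finType) (T : ptree X) : symmetric (adj T) -> irreflexive (adj T) ->
  (\sum_(v : 'I_(vn T)) degree v = 2 * nedges T)%N.
Proof.
move=> sa ia.
have -> : nedges T = (\sum_(u : 'I_(vn T)) \sum_(w | adj T u w && (u < w)) 1)%N.
  by rewrite (big_edges (T := T) addn (fun _ _ => 1%N)) sum1_card.
have -> : (\sum_(v : 'I_(vn T)) degree v = \sum_(u : 'I_(vn T)) \sum_(w | adj T u w && (u < w)) 1
    + \sum_(u : 'I_(vn T)) \sum_(w | adj T u w && (w < u)) 1)%N.
  rewrite -big_split /=; apply: eq_bigr => u _.
  rewrite /degree -sum1_card (bigID (fun w : 'I_(vn T) => (u < w)%N)) /=; congr (_ + _)%N.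
    by apply: eq_bigl => w; rewrite inE.
  apply: eq_bigl => w; rewrite inE -leqNgt leq_eqVlt.
  by have [/val_inj ->|] := eqVneq (w : nat) u; rewrite ?ia.
rewrite mul2n -addnn; congr (_ + _)%N.
rewrite [RHS](exchange_big_dep xpredT) //=; apply: eq_bigr => u _.
by apply: eq_bigl => w; rewrite sa.
Qed.

Lemma card_binary_vertices (X : finType) (T : ptree X) : is_binary_phylo_tree T ->
  ((vn T).+2 = 2 * #|X|)%N.
Proof.
move=> bT; have [sa ia n0 _ nE] := binary_tree bT.
have leaves : #|[set v : 'I_(vn T) | degree v == 1%N]| = #|X|.
  rewrite -cardsT -(card_imset _ (lab_inj bT)); apply: eq_card => v; rewrite inE.
  case: bT => -[_ _ h] _; apply/eqP/imsetP => [/h[x <-]|[x _ ->]]; first by exists x.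
  by apply/h; exists x.
have : (\sum_(v : 'I_(vn T)) (degree v + 2 * (degree v == 1)) = \sum_(v : 'I_(vn T)) 3)%N.
  by apply: eq_bigr => v _; case: bT => _ /(_ v)[] ->.
rewrite big_split /= sum_degree // nE -big_distrr /= -sum1dep_card in leaves *.
rewrite sum_nat_const card_ord.
have -> : (\sum_(v : 'I_(vn T)) (degree v == 1%N) = \sum_(v : 'I_(vn T) | degree v == 1%N) 1)%N.
  by rewrite [RHS]big_mkcond; apply: eq_bigr => v _; case: eqP.
rewrite leaves; lia.
Qed.

Lemma many_close_pairs (X : finType) (T : ptree X) : is_binary_phylo_tree T ->
  (#|X| <= 2 * #|[set p : X * X | (p.1 != p.2) && reach (adj T) 4 (lab T p.1) (lab T p.2)]|)%N.
Proof.
move=> bT; set A := [set p | _].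
have sa := adj_symmetric bT; have ia := adj_irreflexive bT.
pose iso := [set x | [forall y, (x != y) ==> ~~ reach (adj T) 4 (lab T x) (lab T y)]].
have nonisoA : (#|~: iso| <= #|A|)%N.
  apply: leq_trans (leq_imset_card fst A); apply/subset_leq_card/subsetP => x.
  rewrite !inE negb_forall => /existsP[y]; rewrite negb_imply negbK => xy.
  by apply/imsetP; exists (x, y); rewrite ?inE.
have nbr x : exists v, adj T (lab T x) v.
  have : (0 < degree (lab T x))%N by rewrite degree_leaf.
  by rewrite card_gt0 => /set0Pn[v]; rewrite inE => ?; exists v.
have [nb nbP] := choice nbr.
pose nbh x := nb x |: [set w | adj T (nb x) w].
have cardS x : x \in iso -> #|nbh x| = 4.
  rewrite inE => /forallP isox.
  rewrite cardsU1 inE ia add1n; congr S.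
  have [_ /(_ (nb x))] := bT; case=> // d1.
  have [[_ _ /(_ (nb x)) [/(_ d1) [y yE] _]] _] := bT.
  have xy : x != y by apply/eqP => xy; have := nbP x; rewrite -yE xy ia.
  have := isox y; rewrite xy yE implyTb => /negP[].
  by apply: reach_leq (reach_adj (nbP x)).
have reachS x z : z \in nbh x -> reach (adj T) 2 (lab T x) z.
  move=> /setU1P[->|]; first by apply: reach_leq (reach_adj (nbP x)).
  by rewrite inE => xz; apply: reach_cons (nbP x) (reach_adj xz).
have : (\sum_(x in iso) #|nbh x| <= vn T)%N.
  under eq_bigr => x _ do rewrite -sum1_card big_mkcond /=.
  rewrite exchange_big /= -[leqRHS]card_ord -sum1_card.
  apply: leq_sum => z _; rewrite -big_mkcondr /= sum1dep_card.
  apply/card_le1_eqP => x y; rewrite in_set => /andP[xi xz]; rewrite in_set => /andP[yi yz].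
  apply/eqP/negPn/negP => xy; move: yi; rewrite inE => /forallP /(_ x) /implyP.
  move=> /(_ xy) /negP; apply.
  exact: reach_trans (reachS _ _ yz) (reach_sym sa (reachS _ _ xz)).
rewrite (eq_bigr (fun _ => 4%N)) // sum_nat_const.
have := card_binary_vertices bT; have := cardsC iso; lia.
Qed.

Lemma edge_disjoint_short_paths : exists C : nat, forall (X : finType) (T : ptree X),
  is_binary_phylo_tree T ->
  exists (I : {set X * X}) (F : X * X -> {set 'I_(vn T) * 'I_(vn T)}),
    [/\ (#|X| <= C * #|I|)%N,
      forall p, p \in I -> [/\ F p \subset edges T, (#|F p| <= 4)%N &
        forall s, cut (F p) s = s (lab T p.1) (+) s (lab T p.2)],
      forall p, p \in I -> p.1 != p.2 &
      forall p q, p \in I -> q \in I -> p != q ->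
        [disjoint F p & F q] /\ uniq [:: p.1; p.2; q.1; q.2]].
Proof.
exists (2 * (4 ^ 8 * 4 ^ 12))%N => X T bT.
have sa := adj_symmetric bT; have ia := adj_irreflexive bT.
set A := [set p : X * X | (p.1 != p.2) && reach (adj T) 4 (lab T p.1) (lab T p.2)].
have exF (p : X * X) : exists F : {set 'I_(vn T) * 'I_(vn T)}, p \in A ->
    [/\ F \subset edges T, (#|F| <= 4)%N, {in F, forall e, reach (adj T) 4 (lab T p.1) e.1} &
      forall s, cut F s = s (lab T p.1) (+) s (lab T p.2)].
  have [|pA] := boolP (p \in A); last by exists set0.
  by rewrite inE => /andP[_ /(reach_edges sa ia)[F FP]]; exists F.
have [F FP] := choice exF.
pose r (p q : X * X) := ~~ [disjoint F p & F q] || 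
    [|| p.1 == q.1, p.1 == q.2, p.2 == q.1 | p.2 == q.2].
have sr : symmetric r.
  move=> p q; rewrite /r disjoint_sym !(eq_sym q.1) !(eq_sym q.2).
  by do !case: (_ == _); rewrite ?orbT ?orbF.
have [I [IA Ir Id _]] := maximum_independent_set A sr.
exists I, F; split.
- rewrite -mulnA; apply: leq_trans (many_close_pairs bT) _; rewrite -/A leq_mul2l /=.
  apply: card_dominated Id _ => q qI; have qA := subsetP IA _ qI.
  apply: (@leq_trans #|setX [set y | reach (adj T) 8 (lab T q.1) (lab T y)]
                             [set y | reach (adj T) 12 (lab T q.1) (lab T y)]|).
    apply/subset_leq_card/subsetP => p; rewrite inE => /andP[pA pq].
    have pr : reach (adj T) 4 (lab T p.1) (lab T p.2) by move: pA; rewrite inE => /andP[].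
    have qr : reach (adj T) 4 (lab T q.1) (lab T q.2) by move: qA; rewrite inE => /andP[].
    have qp : reach (adj T) 8 (lab T q.1) (lab T p.1).
      have two u v : reach (adj T) 4 u v -> reach (adj T) 8 u v by apply: reach_leq.
      case/orP: pq => [/eqP ->|/orP[]]; first exact: reach_refl.
        rewrite -setI_eq0 => /set0Pn[e /setIP[eP eQ]].
        have [_ _ /(_ _ eP) pe _] := FP _ pA; have [_ _ /(_ _ eQ) qe _] := FP _ qA.
        exact: reach_trans qe (reach_sym sa pe).
      move=> /or4P[] /eqP E.
      - by rewrite E; apply: reach_refl.
      - by rewrite E; apply: two.
      - by rewrite -E; apply/two/reach_sym.
      - by apply: reach_trans qr _; rewrite -E; apply: reach_sym.
    by rewrite !inE qp /=; apply: reach_trans qp pr.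
  by rewrite cardsX; apply: leq_mul; apply: card_label_reach.
- by move=> p /(subsetP IA) /FP[].
- by move=> p /(subsetP IA); rewrite inE => /andP[].
- move=> p q pI qI pq; have := Ir p q pI qI pq; rewrite negb_or negbK => /andP[-> h].
  have := subsetP IA _ pI; have := subsetP IA _ qI; rewrite !inE => /andP[q12 _] /andP[p12 _].
  split=> //; move: h; rewrite /= !inE !negb_or p12 q12 /= !andbT.
  by move=> /and4P[-> -> -> ->].
Qed.

(* Distinguish the two laws by the event [c / 2 <= S], using Chebyshev under each. *)
Lemma second_moment_distance (R : realType) (W : finType) (P1 P2 S : W -> R) (mu c : R) :
  (forall w, 0 <= P1 w) -> (forall w, 0 <= P2 w) ->
  \sum_w P1 w = 1 -> \sum_w P2 w = 1 -> 0 < c -> c <= mu ->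
  2 - 8 / c ^+ 2 * (\sum_w P2 w * S w ^+ 2 + \sum_w P1 w * (S w - mu) ^+ 2) <=
  \sum_w `|P1 w - P2 w|.
Proof.
move=> p1 p2 s1 s2 c0 cmu.
have -> : (2 : R) = \sum_w P1 w + \sum_w P2 w by rewrite s1 s2.
rewrite mulrDr !mulr_sumr -!big_split /= -sumrB; apply: ler_sum => w _.
have [a0 b0] := (p1 w, p2 w).
move: (P1 w) (P2 w) (S w) a0 b0 => a b s a0 b0.
have c2 : 0 < c ^+ 2 by rewrite exprn_gt0.
have k0 : 0 <= 8 / c ^+ 2 by apply: divr_ge0; [lra | exact: ltW].
have ba : b - a <= `|a - b| by rewrite distrC ler_norm.
have ab : a - b <= `|a - b| by apply: ler_norm.
have [cs|sc] := leP (c / 2) s.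
- have h : 2 <= 8 / c ^+ 2 * s ^+ 2.
    rewrite mulrAC ler_pdivlMr //.
    have : (c / 2) ^+ 2 <= s ^+ 2 by rewrite lerXn2r ?nnegrE //; lra.
    by rewrite !expr2; lra.
  have h1 : b * 2 <= b * (8 / c ^+ 2 * s ^+ 2) by apply: ler_wpM2l.
  have h2 : 0 <= 8 / c ^+ 2 * (a * (s - mu) ^+ 2).
    by apply: mulr_ge0 => //; apply: mulr_ge0 => //; apply: sqr_ge0.
  have -> : 8 / c ^+ 2 * (b * s ^+ 2) = b * (8 / c ^+ 2 * s ^+ 2) by rewrite mulrCA.
  lra.
- have h : 2 <= 8 / c ^+ 2 * (s - mu) ^+ 2.
    rewrite mulrAC ler_pdivlMr //.
    have : (c / 2) ^+ 2 <= (mu - s) ^+ 2 by rewrite lerXn2r ?nnegrE //; lra.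
    by rewrite -(sqrrN (s - mu)) opprB !expr2; lra.
  have h1 : a * 2 <= a * (8 / c ^+ 2 * (s - mu) ^+ 2) by apply: ler_wpM2l.
  have h2 : 0 <= 8 / c ^+ 2 * (b * s ^+ 2).
    by apply: mulr_ge0 => //; apply: mulr_ge0 => //; apply: sqr_ge0.
  have -> : 8 / c ^+ 2 * (a * (s - mu) ^+ 2) = a * (8 / c ^+ 2 * (s - mu) ^+ 2) by rewrite mulrCA.
  lra.
Qed.

(** * Counting binary trees *)

Section TreeOn.
Variables (X V : finType) (a : rel V) (l : X -> V).

Definition ptree_on : ptree X :=
  @PTree X #|V| (fun i j => a (enum_val i) (enum_val j)) (fun x => enum_rank (l x)).

Lemma degree_on (i : 'I_(vn ptree_on)) : degree i = #|[set w | a (enum_val i) w]|.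
Proof.
rewrite /degree -(card_imset _ (@enum_rank_inj V)); apply: eq_card => j.
rewrite inE /=; apply/idP/imsetP => [ij|[w]].
  by exists (enum_val j); rewrite ?inE ?enum_valK.
by rewrite inE => iw ->; rewrite enum_rankK.
Qed.

Lemma reach_connect k u v : reach a k u v -> connect a u v.
Proof.
elim: k u => [|k IH] u; first by move=> /eqP ->.
move=> /existsP[z /andP[uz /IH zv]]; apply: connect_trans zv.
by case/orP: uz => [/eqP -> // | /connect1].
Qed.

End TreeOn.

Lemma ptree_on_binary (X V : finType) (a : rel V) (l : X -> V) :
  symmetric a -> irreflexive a -> (0 < #|V|)%N -> (forall u v, connect a u v) ->
  (\sum_v #|[set w | a v w]| = 2 * #|V|.-1)%N -> injective l ->
  (forall v, #|[set w | a v w]| = 1%N <-> exists x, l x = v) ->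
  (forall v, #|[set w | a v w]| = 1%N \/ #|[set w | a v w]| = 3%N) ->
  is_binary_phylo_tree (ptree_on a l).
Proof.
move=> sa ia V0 conn sumd linj leaf deg.
have sa' : symmetric (adj (ptree_on a l)) by move=> i j; apply: sa.
have ia' : irreflexive (adj (ptree_on a l)) by move=> i; apply: ia.
split; last by move=> i; rewrite degree_on; apply: deg.
split; [split=> // | | ].
- move=> i j; have [k /(@reach_iso _ _ a (adj (ptree_on a l)) enum_rank)] :=
    connect_reach (conn (enum_val i) (enum_val j)).
  rewrite !enum_valK => h; apply: reach_connect (h _) => u v uv.
  by rewrite /= !enum_rankK.
- have sumE : (\sum_(i : 'I_(vn (ptree_on a l))) degree i = \sum_v #|[set w | a v w]|)%N.
    rewrite [RHS](reindex (fun i : 'I_#|V| => enum_val i)) /=.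
      by apply: eq_bigr => i _; apply: degree_on.
    by exists enum_rank => i _; rewrite ?enum_valK ?enum_rankK.
  have := sum_degree sa' ia'; rewrite sumE sumd => /eqP.
  by rewrite eqn_pmul2l // => /eqP <-.
- by move=> x y /enum_rank_inj /linj.
- move=> i; rewrite degree_on; split=> [/leaf[x xE]|[x <-]].
    by exists x; rewrite /= xE enum_valK.
  by apply/leaf; exists x; rewrite enum_rankK.
Qed.

Definition rigid (X : finType) (T : ptree X) : Prop :=
  forall phi : 'I_(vn T) -> 'I_(vn T), bijective phi ->
    (forall u v, adj T (phi u) (phi v) = adj T u v) ->
    (forall x, phi (lab T x) = lab T x) -> forall v, phi v = v.

Lemma ptree_on_iso (X V W : finType) (a : rel V) (b : rel W) (l : X -> V) (m : X -> W) phi :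
  bijective phi ->
  (forall u v, adj (ptree_on b m) (phi u) (phi v) = adj (ptree_on a l) u v) ->
  (forall x, phi (lab (ptree_on a l) x) = lab (ptree_on b m) x) ->
  exists psi : V -> W, [/\ bijective psi, (forall u v, b (psi u) (psi v) = a u v),
    (forall x, psi (l x) = m x) & (forall v, psi v = enum_val (phi (enum_rank v)))].
Proof.
move=> bphi aphi lphi; exists (fun v => enum_val (phi (enum_rank v))); split=> //.
- apply: bij_comp (bij_comp bphi (@enum_rank_bij V)).
  exact: enum_val_bij.
- by move=> u v; have := aphi (enum_rank u) (enum_rank v); rewrite /= !enum_rankK.
- by move=> x; have /= -> := lphi x; rewrite enum_rankK.
Qed.

Lemma card_set_option (V : finType) (P : pred (option V)) :
  (#|[set w | P w]| = P None + #|[set v | P (Some v)]|)%N.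
Proof.
rewrite (cardsD1 None) inE; congr (_ + _)%N.
rewrite -[RHS](card_imset _ (fun x y : V => @Some_inj _ x y)); apply: eq_card => -[v|]; rewrite !inE /=.
  by rewrite mem_imset ?inE //; apply: Some_inj.
by apply/esym/imsetP => -[].
Qed.

Lemma sum_option (V : finType) (h : option V -> nat) :
  (\sum_w h w = h None + \sum_v h (Some v))%N.
Proof.
rewrite (bigD1 None) //=; congr (_ + _)%N.
rewrite (reindex_omap (fun v => Some v) id) /=; last by case.
by apply: eq_bigl => v; rewrite eqxx.
Qed.

Section Attach.
Variables (X : finType) (x0 : X) (T : ptree {x | x != x0}).
Local Notation V := 'I_(vn T).
Variable e : V * V.

(* The edge [e] is subdivided by the new vertex [Some None], to which the new leaf
   [None], labelled [x0], is attached. *)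
Definition attach_adj : rel (option (option V)) := fun u w =>
  match u, w with
  | None, Some None | Some None, None => true
  | Some None, Some (Some v) | Some (Some v), Some None => (v == e.1) || (v == e.2)
  | Some (Some u), Some (Some v) =>
      adj T u v && ~~ ((u == e.1) && (v == e.2) || (u == e.2) && (v == e.1))
  | _, _ => false
  end.

Definition attach_lab (x : X) : option (option V) :=
  if insub x is Some y then Some (Some (lab T y)) else None.

Definition attach : ptree X := ptree_on attach_adj attach_lab.

Hypotheses (bT : is_binary_phylo_tree T) (eT : adj T e.1 e.2).

Let e12 : e.1 == e.2 = false.
Proof. by apply/negP => /eqP e12; move: eT; rewrite e12 adj_irreflexive. Qed.

Lemma attach_sym : symmetric attach_adj.
Proof.
move=> [[u|]|] [[v|]|] //=; rewrite (adj_symmetric bT); congr (_ && ~~ _).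
by rewrite orbC; congr orb; apply: andbC.
Qed.

Lemma attach_degree_old v : #|[set w | attach_adj (Some (Some v)) w]| = degree v.
Proof.
rewrite 2!card_set_option /= add0n /degree.
have [->|v1] := eqVneq v e.1.
  rewrite [RHS](cardsD1 e.2) inE eT; congr addn; apply: eq_card => w.
  by rewrite !inE e12 /= orbF andbC.
have [->|v2] := eqVneq v e.2.
  rewrite [RHS](cardsD1 e.1) inE (adj_symmetric bT) eT; congr addn; apply: eq_card => w.
  by rewrite !inE /= andbC.
by apply: eq_card => w; rewrite !inE andbT.
Qed.

Lemma attach_degree_leaf : #|[set w | attach_adj None w]| = 1%N.
Proof. by rewrite 2!card_set_option /= eq_card0 // => v; rewrite inE. Qed.

Lemma attach_degree_mid : #|[set w | attach_adj (Some None) w]| = 3%N.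
Proof.
rewrite 2!card_set_option /= add0n; have -> : [set v | (v == e.1) || (v == e.2)] = [set e.1; e.2].
  by apply/setP => v; rewrite !inE.
by rewrite cards2 e12.
Qed.

Lemma attach_connect u v : connect attach_adj u v.
Proof.
have csym : connect_sym attach_adj by apply/sym_connect_sym/attach_sym.
have mid u' : u' = e.1 \/ u' = e.2 -> connect attach_adj (Some None) (Some (Some u')).
  by move=> h; apply: connect1 => /=; case: h => ->; rewrite eqxx ?orbT.
have old u' v' : connect attach_adj (Some (Some u')) (Some (Some v')).
  have [_ _ _ /(_ u' v') /connectP[p up ->] _] := binary_tree bT.
  elim: p u' up => [|w p IH] u' //= /andP[uw /IH wp]; apply: connect_trans wp.
  have [/orP[] /andP[/eqP -> /eqP ->]|no] :=
    boolP ((u' == e.1) && (w == e.2) || (u' == e.2) && (w == e.1)).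
  - by apply: (@connect_trans _ _ (Some None)); [rewrite csym|]; apply: mid; [left|right].
  - by apply: (@connect_trans _ _ (Some None)); [rewrite csym|]; apply: mid; [right|left].
  - by apply: connect1; rewrite /= uw.
have all w : connect attach_adj (Some None) w.
  case: w => [[w|]|] //; last exact: connect1.
  by apply: connect_trans (old e.1 w); apply: mid; left.
by apply: connect_trans (all v); rewrite csym.
Qed.

Lemma attach_binary : is_binary_phylo_tree attach.
Proof.
apply: ptree_on_binary.
- exact: attach_sym.
- by move=> [[v|]|] //=; rewrite (adj_irreflexive bT).
- by rewrite card_option.
- exact: attach_connect.
- rewrite !sum_option attach_degree_leaf attach_degree_mid.
  under eq_bigr => v _ do rewrite attach_degree_old.
  have [sa ia n0 _ nE] := binary_tree bT.
  by rewrite (sum_degree sa ia) nE !card_option card_ord; lia.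
- move=> x y; rewrite /attach_lab.
  case: insubP => [x' _ <-|/negPn/eqP ->]; case: insubP => [y' _ <-|/negPn/eqP ->] //.
  by case=> /(lab_inj bT) ->.
- have [[_ _ leaf] _] := bT.
  move=> [[v|]|]; rewrite ?attach_degree_old ?attach_degree_mid ?attach_degree_leaf.
  + rewrite leaf; split=> -[x xE]; last first.
      by move: xE; rewrite /attach_lab; case: insubP => // y _ _ [<-]; exists y.
    by exists (val x); rewrite /attach_lab valK xE.
  + by split=> // -[x]; rewrite /attach_lab; case: insubP.
  + by split=> // _; exists x0; rewrite /attach_lab insubF ?eqxx.
- move=> [[v|]|]; rewrite ?attach_degree_old ?attach_degree_mid ?attach_degree_leaf.
  + by case: bT => _; apply.
  + by right.
  + by left.
Qed.

End Attach.

Lemma attach_iso (X : finType) (x0 : X) (T T' : ptree {x | x != x0}) e e' phi :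
  is_binary_phylo_tree T -> is_binary_phylo_tree T' -> adj T e.1 e.2 -> adj T' e'.1 e'.2 ->
  bijective phi ->
  (forall u v, attach_adj e' (phi u) (phi v) = attach_adj e u v) ->
  (forall x, phi (attach_lab T x) = attach_lab T' x) ->
  exists psi : 'I_(vn T) -> 'I_(vn T'),
    [/\ bijective psi, (forall u v, adj T' (psi u) (psi v) = adj T u v),
      (forall x, psi (lab T x) = lab T' x),
      (phi None = None /\ phi (Some None) = Some None) &
      (forall v, phi (Some (Some v)) = Some (Some (psi v)) /\
         ((psi v == e'.1) || (psi v == e'.2)) = ((v == e.1) || (v == e.2)))].
Proof.
move=> bT bT' eT eT' bphi aphi lphi; have iphi := bij_inj bphi.
have phi0 : phi None = None by have := lphi x0; rewrite /attach_lab !insubF ?eqxx.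
have phi1 : phi (Some None) = Some None.
  by have := aphi None (Some None); rewrite phi0 /=; case: (phi _) => [[]|].
pose psi v := if phi (Some (Some v)) is Some (Some w) then w else e'.1.
have phiE v : phi (Some (Some v)) = Some (Some (psi v)).
  rewrite /psi; case E: (phi _) => [[w|]|] //.
    by have := iphi (Some (Some v)) (Some None); rewrite E phi1 => /(_ erefl).
  by have := iphi (Some (Some v)) None; rewrite E phi0 => /(_ erefl).
have psie v : ((psi v == e'.1) || (psi v == e'.2)) = ((v == e.1) || (v == e.2)).
  by have := aphi (Some None) (Some (Some v)); rewrite phi1 phiE.
have ipsi : injective psi.
  by move=> u v uv; have := iphi (Some (Some u)) (Some (Some v)); rewrite !phiE uv => /(_ erefl) [].
exists psi; split=> //.
- apply: inj_card_bij ipsi _; have := bij_eq_card bphi.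
  by rewrite !card_option => -[->].
- have both (U : ptree {x | x != x0}) (f : 'I_(vn U) * 'I_(vn U)) (bU : is_binary_phylo_tree U)
      (fU : adj U f.1 f.2) u v :
    ((u == f.1) && (v == f.2) || (u == f.2) && (v == f.1)) =
    [&& (u == f.1) || (u == f.2), (v == f.1) || (v == f.2) & u != v].
    have f12 : f.1 != f.2 by apply: contraTneq fU => ->; rewrite adj_irreflexive.
    have [->|u1] := eqVneq u f.1; have [->|v1] := eqVneq v f.1.
    + by rewrite ?eqxx (negPf f12) !andbF.
    + by rewrite ?eqxx (negPf f12) /= ?andbT ?andbF ?orbF.
    + by rewrite ?eqxx ?(negPf f12) /= ?u1 ?andbF ?andbT ?orbF.
    + by case: (u =P f.2) => [->|_]; case: (v =P f.2) => [E|_]; rewrite ?E ?eqxx ?andbF.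
  have adjb (U : ptree {x | x != x0}) (f : 'I_(vn U) * 'I_(vn U)) (bU : is_binary_phylo_tree U)
      (fU : adj U f.1 f.2) u v :
      (u == f.1) && (v == f.2) || (u == f.2) && (v == f.1) -> adj U u v.
    by case/orP => /andP[/eqP -> /eqP ->] //; rewrite (adj_symmetric bU).
  move=> u v; have := aphi (Some (Some u)) (Some (Some v)); rewrite !phiE /=.
  have := both _ _ bT' eT' (psi u) (psi v); rewrite !psie (inj_eq ipsi) -(both _ _ bT eT) => E.
  move: (adjb _ _ bT' eT' (psi u) (psi v)) (adjb _ _ bT eT u v); rewrite E.
  case: (_ || _); last by rewrite !andbT.
  by move=> -> // ->.
- move=> y; have := lphi (val y); rewrite /attach_lab !valK phiE => -[] //.
Qed.

Lemma attach_rigid (X : finType) (x0 : X) (T : ptree {x | x != x0}) e :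
  is_binary_phylo_tree T -> adj T e.1 e.2 -> rigid T -> rigid (attach e).
Proof.
move=> bT eT rT phi bphi aphi lphi v.
have [chi [bchi achi lchi chiE]] := ptree_on_iso bphi aphi lphi.
have [psi [bpsi apsi lpsi [chi0 chi1] psiE]] := attach_iso bT bT eT eT bchi achi lchi.
have id : forall w, chi w = w.
  by case=> [[w|]|] //; rewrite (psiE w).1 (rT psi).
have := id (enum_val v); rewrite chiE enum_valK => /enum_val_inj; exact.
Qed.

Lemma tree_countS n : (2 <= n)%N -> tree_count n.+1 = (tree_count n * (2 * n - 3))%N.
Proof.
case: n => [|[|n]] // _; rewrite /tree_count /= big_nat_recr //=; congr muln.
by rewrite !mulnS; lia.
Qed.

Lemma edge_ext (X : finType) (T : ptree X) (e e' : 'I_(vn T) * 'I_(vn T)) :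
  e \in edges T -> e' \in edges T ->
  (forall v, ((v == e'.1) || (v == e'.2)) = ((v == e.1) || (v == e.2))) -> e = e'.
Proof.
case: e e' => [a b] [c d]; rewrite !inE /= => /andP[_ ab] /andP[_ cd] h.
have := h a; have := h b; rewrite !eqxx ?orbT /= => /orP[]/eqP bE /orP[]/eqP aE; subst.
- by rewrite ltnn in ab.
- by rewrite ltnNge ltnW in cd.
- by [].
- by rewrite ltnn in ab.
Qed.

Lemma rigid_family n (X : finType) : (2 <= n)%N -> #|X| = n ->
  exists (I : finType) (T : I -> ptree X), [/\ #|I| = tree_count n,
    (forall i, is_binary_phylo_tree (T i)), (forall i, rigid (T i)) &
    (forall i j, ptree_iso (T i) (T j) -> i = j)].
Proof.
elim: n X => // n IH X n1 Xn.
have [n2|n2] := leqP 2 n; last first.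
  have {n1 n2} n1 : n = 1%N by lia.
  rewrite {}n1 {n IH} in Xn *.
  have degX (v : X) : #|[set w | v != w]| = 1%N.
    have -> : [set w | v != w] = [set~ v] by apply/setP => w; rewrite !inE eq_sym.
    by rewrite cardsC1 Xn.
  exists unit, (fun=> ptree_on (fun u v : X => u != v) id); split=> //.
  - by rewrite card_unit /tree_count big_geq.
  - move=> _; apply: ptree_on_binary => //.
    + by move=> u v; rewrite eq_sym.
    + by move=> u; rewrite eqxx.
    + by rewrite Xn.
    + move=> u v; have [->|uv] := eqVneq u v; first exact: connect0.
      exact: connect1.
    + by rewrite (eq_bigr (fun=> 1%N)) // sum1_card Xn.
    + by move=> v; split=> // _; exists v.
    + by left.
  - move=> _ phi _ _ lphi v; have := lphi (enum_val v); rewrite /= enum_valK; exact.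
  - by move=> [] [].
have [x0 _] : exists x0 : X, x0 \in X by apply/card_gt0P; rewrite Xn.
have Yn : #|{: {x | x != x0}}| = n.
  by rewrite card_sig; transitivity #|predC1 x0|; [apply: eq_card | rewrite cardC1 Xn].
have [I [T [In Tb Tr Ti]]] := IH _ n2 Yn.
pose J i : finType := {e : 'I_(vn (T i)) * 'I_(vn (T i)) | e \in edges (T i)}.
have Jadj i (e : J i) : adj (T i) (sval e).1 (sval e).2 by apply: edges_adj (valP e).
exists {i : I & J i}, (fun s : {i : I & J i} => @attach X x0 (T (tag s)) (sval (tagged s))); split.
- rewrite card_tagged sumnE big_map big_enum /= tree_countS // -In -sum_nat_const.
  apply: eq_bigr => i _; rewrite card_sig.
  have [_ _ _ _ nE] := binary_tree (Tb i).
  have := card_binary_vertices (Tb i); rewrite Yn.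
  have -> : #|[pred e | e \in edges (T i)]| = (vn (T i)).-1 by rewrite -nE.
  lia.
- by move=> [i e]; apply: attach_binary => //=; apply: Jadj.
- by move=> [i e]; apply: attach_rigid => //=; apply: Jadj.
- move=> [i e] [j e'] [phi [bphi aphi lphi]].
  have [chi [bchi achi lchi chiE]] := ptree_on_iso bphi aphi lphi.
  have [psi [bpsi apsi lpsi _ psiE]] :=
    attach_iso (Tb i) (Tb j) (Jadj i e) (Jadj j e') bchi achi lchi.
  have ij : i = j by apply: Ti; exists psi.
  subst j; congr existT; apply/val_inj/edge_ext; [exact: valP | exact: valP |].
  by move=> v; rewrite -(psiE v).2 (Tr i psi).
Qed.

(** * Trees in which two given leaves are close *)

Lemma ptree_iso_refl (X : finType) (T : ptree X) : ptree_iso T T.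
Proof. by exists id; split=> //; exists id. Qed.

Lemma ptree_iso_sym (X : finType) (T1 T2 : ptree X) : ptree_iso T1 T2 -> ptree_iso T2 T1.
Proof.
case=> phi [[psi phiK psiK] aphi lphi]; exists psi; split.
- by exists phi.
- by move=> u v; rewrite -aphi !psiK.
- by move=> x; rewrite -lphi phiK.
Qed.

Lemma ptree_iso_trans (X : finType) (T1 T2 T3 : ptree X) :
  ptree_iso T1 T2 -> ptree_iso T2 T3 -> ptree_iso T1 T3.
Proof.
move=> [phi [bphi aphi lphi]] [psi [bpsi apsi lpsi]]; exists (psi \o phi); split.
- exact: bij_comp.
- by move=> u v; rewrite /= apsi aphi.
- by move=> x; rewrite /= lphi lpsi.
Qed.

Definition tree_reach (X : finType) (T : ptree X) (k : nat) (x y : X) : bool :=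
  reach (adj T) k (lab T x) (lab T y).

Lemma tree_reach_iso (X : finType) (T1 T2 : ptree X) k x y :
  ptree_iso T1 T2 -> tree_reach T1 k x y -> tree_reach T2 k x y.
Proof.
case=> phi [_ aphi lphi]; rewrite /tree_reach -!lphi.
by apply: reach_iso => u v; rewrite aphi.
Qed.

Section Representatives.
Variables (X : finType) (N : nat).

Local Notation graph := ({ffun 'I_N * 'I_N -> bool} * {ffun X -> 'I_N})%type.

Definition graph_tree (d : graph) : ptree X :=
  @PTree X N (fun u v => d.1 (u, v)) (fun x => d.2 x).

Definition relabel (h : {perm X}) (d : graph) : graph := (d.1, [ffun x => d.2 (h x)]).

Lemma graph_treeP (T : ptree X) : vn T = N -> exists d, graph_tree d = T.
Proof.
case: T => n a l /= nN; subst n.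
exists ([ffun uv => a uv.1 uv.2], [ffun x => l x]); rewrite /graph_tree /=.
congr PTree; last by apply/funext => x; rewrite ffunE.
by apply/funext => u; apply/funext => v; rewrite ffunE.
Qed.

Lemma relabel_binary h d :
  is_binary_phylo_tree (graph_tree d) -> is_binary_phylo_tree (graph_tree (relabel h d)).
Proof.
case=> -[tT linj leaf] deg; split; [split|] => //.
- by move=> x y /=; rewrite !ffunE => /linj /perm_inj.
- move=> v; rewrite -[degree v]/(@degree X (graph_tree d) v) leaf.
  split=> -[x <-]; last by exists (h x); rewrite /= ffunE.
  by exists (h^-1%g x); rewrite /= ffunE permKV.
Qed.

Lemma relabel_iso h d d' :
  ptree_iso (graph_tree (relabel h d)) (graph_tree (relabel h d')) ->
  ptree_iso (graph_tree d) (graph_tree d').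
Proof.
case=> phi [bphi aphi lphi]; exists phi; split=> // x.
by have := lphi (h^-1%g x); rewrite /= !ffunE permKV.
Qed.

Lemma relabel_reach h d k x y :
  tree_reach (graph_tree (relabel h d)) k x y = tree_reach (graph_tree d) k (h x) (h y).
Proof. by rewrite /tree_reach /= !ffunE. Qed.

Variable Rep : {set graph}.
Hypotheses (Rep_binary : forall d, d \in Rep -> is_binary_phylo_tree (graph_tree d))
  (Rep_inj : forall d d', d \in Rep -> d' \in Rep ->
     ptree_iso (graph_tree d) (graph_tree d') -> d = d')
  (Rep_full : forall d, is_binary_phylo_tree (graph_tree d) ->
     exists2 d', d' \in Rep & ptree_iso (graph_tree d) (graph_tree d')).

Lemma card_reach_perm (h : {perm X}) k x y :
  (#|[set d in Rep | tree_reach (graph_tree d) k (h x) (h y)]| <=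
   #|[set d in Rep | tree_reach (graph_tree d) k x y]|)%N.
Proof.
have ex d : exists d', d \in Rep ->
    d' \in Rep /\ ptree_iso (graph_tree (relabel h d)) (graph_tree d').
  have [dR|_] := boolP (d \in Rep); last by exists d.
  by have [d' d'R iso] := Rep_full (relabel_binary h (Rep_binary dR)); exists d'.
have [f fP] := choice ex.
set A := (X in (#|pred_of_set X| <= _)%N).
have finj : {in A &, injective f}.
  move=> d d'; rewrite !inE => /andP[dR _] /andP[d'R _] E; apply: Rep_inj => //.
  apply: (@relabel_iso h); apply: ptree_iso_trans (fP _ dR).2 _.
  by rewrite E; apply/ptree_iso_sym/(fP _ d'R).2.
rewrite -(card_in_imset finj); apply/subset_leq_card/subsetP => _ /imsetP[d + ->].
rewrite !inE => /andP[dR dr]; have [-> iso] := fP _ dR.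
by apply: tree_reach_iso iso _; rewrite relabel_reach.
Qed.

(* Averaging over the second label: all of them are equivalent by symmetry, while a
   binary tree has at most [4 ^ k] leaves within distance [k] of [x]. *)
Lemma card_reach_average k x y : x != y ->
  (#|[set d in Rep | tree_reach (graph_tree d) k x y]| * #|X|.-1 <= #|Rep| * 4 ^ k)%N.
Proof.
move=> xy.
apply: (@leq_trans (\sum_(z | z != x) #|[set d in Rep | tree_reach (graph_tree d) k x z]|)%N).
  rewrite mulnC -(cardC1 x) -sum_nat_const; apply: leq_sum => z zx.
  have := card_reach_perm (tperm y z) k x z.
  by rewrite tpermR tpermD // eq_sym.
under eq_bigr => z _ do rewrite -sum1_card big_mkcond /=.
rewrite exchange_big /=.
apply: (@leq_trans (\sum_(d in Rep) 4 ^ k)%N); last by rewrite sum_nat_const.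
rewrite [leqRHS]big_mkcond /=; apply: leq_sum => d _.
rewrite -big_mkcondr /=; have [dR|dR] := boolP (d \in Rep); last first.
  by rewrite big1 // => z; rewrite inE (negPf dR) andbF.
apply: leq_trans (card_label_reach (Rep_binary dR) k x); rewrite -sum1_card.
rewrite big_mkcond [leqRHS]big_mkcond /=; apply: leq_sum => z _.
by rewrite !inE dR /tree_reach /=; case: (z != x) => //=; case: reach.
Qed.

End Representatives.

Lemma representative_family (X : finType) : (2 <= #|X|)%N ->
  exists (k : nat) (T : 'I_k -> ptree X), [/\ (tree_count #|X| <= k)%N,
    (forall i j, ptree_iso (T i) (T j) -> i = j), (forall i, is_binary_phylo_tree (T i)) &
    forall l x y, x != y -> (#|[set i | tree_reach (T i) l x y]| * #|X|.-1 <= k * 4 ^ l)%N].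
Proof.
move=> X2; pose N := (2 * #|X| - 2)%N.
pose r d d' := `[< ptree_iso (@graph_tree X N d) (@graph_tree X N d') >].
have sr : symmetric r by move=> d d'; apply/asboolP/asboolP; apply: ptree_iso_sym.
have [Rep [RepA RepI RepD RepM]] :=
  maximum_independent_set [set d | `[< is_binary_phylo_tree (@graph_tree X N d) >]] sr.
have Rep_binary d : d \in Rep -> is_binary_phylo_tree (graph_tree d).
  by move=> /(subsetP RepA); rewrite inE => /asboolP.
have Rep_inj d d' : d \in Rep -> d' \in Rep ->
    ptree_iso (graph_tree d) (graph_tree d') -> d = d'.
  move=> dR d'R iso; apply/eqP/negPn/negP => /(RepI _ _ dR d'R) /asboolP; exact.
have Rep_full d : is_binary_phylo_tree (@graph_tree X N d) ->
    exists2 d', d' \in Rep & ptree_iso (graph_tree d) (graph_tree d').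
  move=> bd; have [|d' d'R h] := RepD d; first by rewrite inE; apply/asboolP.
  by exists d' => //; case/orP: h => [/eqP ->|/asboolP //]; apply: ptree_iso_refl.
have [I [T [In Tb _ Ti]]] := rigid_family X2 erefl.
have TN i : vn (T i) = N by have := card_binary_vertices (Tb i); rewrite /N; lia.
have [D DE] := choice (fun i => graph_treeP (TN i)).
have Dinj : injective D.
  by move=> i j E; apply: Ti; rewrite -!DE E; apply: ptree_iso_refl.
exists #|Rep|, (fun i => graph_tree (enum_val i)); split.
- rewrite -In -cardsT -(card_imset _ Dinj); apply: RepM.
    by apply/subsetP => _ /imsetP[i _ ->]; rewrite inE DE; apply/asboolP.
  move=> _ _ /imsetP[i _ ->] /imsetP[j _ ->]; apply: contraNN => /asboolP.
  by rewrite !DE => /Ti ->.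
- by move=> i j /Rep_inj => /(_ (enum_valP _) (enum_valP _)) /enum_val_inj.
- by move=> i; apply/Rep_binary/enum_valP.
- move=> l x y xy; apply: leq_trans (card_reach_average Rep_binary Rep_inj Rep_full l xy).
  rewrite leq_mul2r -(card_imset _ (@enum_val_inj _ _)); apply/orP; right.
  apply/subset_leq_card/subsetP => _ /imsetP[i + ->]; rewrite !inE => ->.
  by rewrite enum_valP.
Qed.

(** * The pair statistic *)

Lemma prod_theta_ge (R : realType) (J : finType) (F : {set J}) (h : J -> R) (t : R) n :
  0 <= t -> t <= 1 -> (#|F| <= n)%N -> {in F, forall e, t <= h e} ->
  t ^+ n <= \prod_(e in F) h e.
Proof.
move=> t0 t1 Fn Fh; apply: (@le_trans _ _ (t ^+ #|F|)); first exact: ler_wiXn2l.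
by rewrite -prodr_const; apply: ler_prod => e eF; rewrite t0 Fh.
Qed.

Lemma prod_theta_le (R : realType) (J : finType) (F : {set J}) (h : J -> R) (t : R) n :
  0 <= t -> t <= 1 -> (n <= #|F|)%N -> {in F, forall e, 0 <= h e <= t} ->
  \prod_(e in F) h e <= t ^+ n.
Proof.
move=> t0 t1 Fn Fh; apply: (@le_trans _ _ (t ^+ #|F|)); last exact: ler_wiXn2l.
by rewrite -prodr_const; apply: ler_prod.
Qed.

Section PairStatistic.
Variables (R : realType) (X : finType).

Definition pair_parity (chi : {ffun X -> bool}) (p : X * X) : bool := chi p.1 (+) chi p.2.

Definition pair_sum (I : {set X * X}) (chi : {ffun X -> bool}) : R :=
  \sum_(p in I) (-1) ^+ pair_parity chi p.

Lemma pair_sum_sqr (I : {set X * X}) (P : {ffun X -> bool} -> R) :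
  \sum_chi P chi * pair_sum I chi ^+ 2 =
  \sum_(p in I) \sum_(q in I)
    \sum_chi P chi * (-1) ^+ (pair_parity chi p (+) pair_parity chi q).
Proof.
transitivity (\sum_chi \sum_(p in I) \sum_(q in I)
    P chi * (-1) ^+ (pair_parity chi p (+) pair_parity chi q)).
  apply: eq_bigr => chi _; rewrite expr2 {1}/pair_sum mulr_suml mulr_sumr.
  apply: eq_bigr => p _; rewrite /pair_sum !mulr_sumr; apply: eq_bigr => q _.
  by rewrite signr_addb.
by rewrite exchange_big; apply: eq_bigr => p _; rewrite exchange_big.
Qed.

Variables (T : ptree X) (prob : 'I_(vn T) -> 'I_(vn T) -> R) (I : {set X * X}).
Hypotheses (bT : is_binary_phylo_tree T) (mech : cfn_mech prob).

Let P := cfn_prob prob.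

Lemma cfn_sign_le1 (t : {ffun X -> bool} -> bool) : \sum_chi P chi * (-1) ^+ t chi <= 1.
Proof.
rewrite -[leRHS](cfn_prob_sum1 prob (binary_tree bT)); apply: ler_sum => chi _.
rewrite ler_piMr ?cfn_prob_ge0 //.
by apply: le_trans (ler_norm _) _; rewrite normr_sign.
Qed.

Lemma edge_theta e : e \in edges T -> 0 <= 1 - 2 * prob e.1 e.2 <= 1.
Proof. by move=> /edges_adj /mech[p0 [p1 _]]; lra. Qed.

Lemma four_point_moment (r : R) k x y z w :
  0 <= r -> r <= 1 -> (forall e, e \in edges T -> 1 - 2 * prob e.1 e.2 <= r) ->
  uniq [:: x; y; z; w] ->
  ~~ tree_reach T k x y -> ~~ tree_reach T k x z -> ~~ tree_reach T k x w ->
  \sum_chi P chi * (-1) ^+ (pair_parity chi (x, y) (+) pair_parity chi (z, w)) <= r ^+ k.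
Proof.
move=> r0 r1 er uxyzw nxy nxz nxw.
have [sa ia _ conn _] := binary_tree bT.
have [k1 /(reach_edges sa ia)[F1 [F1E _ _ F1c]]] := connect_reach (conn (lab T x) (lab T y)).
have [k2 /(reach_edges sa ia)[F2 [F2E _ _ F2c]]] := connect_reach (conn (lab T z) (lab T w)).
have FE := symdiff_sub F1E F2E.
rewrite (cfn_moment prob (binary_tree bT) FE); last first.
  by move=> s; rewrite cut_symdiff F1c F2c /pair_parity /= !ffunE.
apply: prod_theta_le => //; last first.
  by move=> e /(subsetP FE) eE; rewrite er // andbT; have /andP[] := edge_theta eE.
rewrite leqNgt; apply/negP => /ltnW Fk.
pose A := [set lab T u | u in [set u in [:: x; y; z; w]]].
have FA s : cut (symdiff F1 F2) s = \big[addb/false]_(u in A) s u.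
  rewrite cut_symdiff F1c F2c big_imset /=; last by move=> ? ? _ _ /(lab_inj bT).
  rewrite (eq_bigl (mem [:: x; y; z; w])); last by move=> u; rewrite inE.
  by rewrite -big_uniq // !big_cons big_nil /= addbF !addbA.
have xA : lab T x \in A by apply/imset_f; rewrite !inE eqxx.
have FT : {in symdiff F1 F2, forall e, adj T e.1 e.2}.
  by move=> e /(subsetP FE) /edges_adj.
have [v [/imsetP[u + ->] ux]] := cut_reach sa ia FT Fk FA xA.
rewrite !inE => /or4P[] /eqP uE; rewrite uE in ux *.
- by rewrite eqxx in ux.
- exact/negP.
- exact/negP.
- exact/negP.
Qed.

Definition close_pairs k (p q : X * X) : bool :=
  (p != q) && [|| tree_reach T k p.1 p.2, tree_reach T k p.1 q.1 | tree_reach T k p.1 q.2].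

Lemma pair_sum_sqr_le (r : R) k :
  0 <= r -> r <= 1 -> (forall e, e \in edges T -> 1 - 2 * prob e.1 e.2 <= r) ->
  (forall p q, p \in I -> q \in I -> p != q -> uniq [:: p.1; p.2; q.1; q.2]) ->
  \sum_chi P chi * pair_sum I chi ^+ 2 <=
  #|I|%:R + (\sum_(p in I) \sum_(q in I) close_pairs k p q)%:R + #|I|%:R ^+ 2 * r ^+ k.
Proof.
move=> r0 r1 er Iu; rewrite pair_sum_sqr.
have -> : #|I|%:R + (\sum_(p in I) \sum_(q in I) close_pairs k p q)%:R + #|I|%:R ^+ 2 * r ^+ k =
    \sum_(p in I) \sum_(q in I) ((q == p)%:R + (close_pairs k p q)%:R + r ^+ k) :> R.
  rewrite (eq_bigr (fun p => 1 + \sum_(q in I) (close_pairs k p q)%:R + #|I|%:R * r ^+ k)).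
    rewrite !big_split /= !sumr_const; congr (_ + _ + _).
      by rewrite natr_sum; apply: eq_bigr => p _; rewrite natr_sum.
    by rewrite -[RHS]mulr_natl mulrA.
  move=> p pI; rewrite !big_split /= sumr_const mulr_natl; congr (_ + _ + _).
  rewrite (bigD1 p) //= eqxx big1 ?addr0 // => q /andP[_ /negPf ->] //.
apply: ler_sum => p pI; apply: ler_sum => q qI.
have rk : 0 <= r ^+ k by apply: exprn_ge0.
have [->|qp] := eqVneq q p.
  apply: le_trans (cfn_sign_le1 _) _; rewrite -addrA lerDl.
  by apply: addr_ge0.
have [pq|] := boolP (close_pairs k p q).
  by apply: le_trans (cfn_sign_le1 _) _; rewrite mulr0n mulr1n add0r lerDl.
rewrite /close_pairs eq_sym qp /= !negb_or => /and3P[h1 h2 h3].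
rewrite add0r add0r; have := @four_point_moment r k p.1 p.2 q.1 q.2 r0 r1 er _ h1 h2 h3.
by rewrite -!surjective_pairing; apply; apply: Iu => //; rewrite eq_sym.
Qed.

Variable F : X * X -> {set 'I_(vn T) * 'I_(vn T)}.
Hypotheses (FP : forall p, p \in I -> F p \subset edges T /\
    forall s, cut (F p) s = s (lab T p.1) (+) s (lab T p.2))
  (Fdisj : forall p q, p \in I -> q \in I -> p != q -> [disjoint F p & F q]).

Let mean p := \prod_(e in F p) (1 - 2 * prob e.1 e.2).

Lemma pair_sum_variance :
  \sum_chi P chi * (pair_sum I chi - \sum_(p in I) mean p) ^+ 2 <= #|I|%:R.
Proof.
have tT := binary_tree bT.
have E1 p : p \in I -> \sum_chi P chi * (-1) ^+ pair_parity chi p = mean p.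
  by move=> /FP[FE Fc]; apply: cfn_moment => // s; rewrite Fc /pair_parity !ffunE.
have ES : \sum_chi P chi * pair_sum I chi = \sum_(p in I) mean p.
  under eq_bigr => chi _ do rewrite mulr_sumr.
  by rewrite exchange_big; apply: eq_bigr.
have E2 p q : p \in I -> q \in I -> q != p ->
    \sum_chi P chi * (-1) ^+ (pair_parity chi p (+) pair_parity chi q) = mean p * mean q.
  move=> pI qI qp; have [pE pc] := FP pI; have [qE qc] := FP qI.
  have dis : [disjoint F p & F q] by apply: Fdisj; rewrite // eq_sym.
  have -> : mean p * mean q = \prod_(e in symdiff (F p) (F q)) (1 - 2 * prob e.1 e.2).
    rewrite /mean -bigU //=; apply: eq_bigl => e; rewrite !inE.
    by case: (boolP (e \in F p)) => [/(disjointFr dis) ->|_].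
  apply: cfn_moment (symdiff_sub pE qE) _ => // s.
  by rewrite cut_symdiff pc qc /pair_parity !ffunE.
have varE m : \sum_chi P chi * (pair_sum I chi - m) ^+ 2 =
    \sum_chi P chi * pair_sum I chi ^+ 2 - 2 * m * \sum_chi P chi * pair_sum I chi
    + m ^+ 2 * \sum_chi P chi.
  by rewrite !mulr_sumr -sumrB -big_split /=; apply: eq_bigr => chi _; ring.
rewrite varE ES /P cfn_prob_sum1 // -/P; set mu := \sum_(p in I) mean p.
have -> : forall y, y - 2 * mu * mu + mu ^+ 2 * 1 = y - mu * mu by move=> y; ring.
rewrite pair_sum_sqr {1}/mu mulr_suml -sumrB -sum1_card natr_sum.
apply: ler_sum => p pI; rewrite mulr_sumr -sumrB (bigD1 p) //= [X in _ + X]big1 ?addr0.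
  apply: le_trans (cfn_sign_le1 (fun chi => pair_parity chi p (+) pair_parity chi p)).
  by rewrite gerBl -expr2 sqr_ge0.
by move=> q /andP[qI qp]; rewrite E2 // subrr.
Qed.

End PairStatistic.

(** * Separation of the two laws *)

Lemma sum_close_pairs (X : finType) (k : nat) (T : 'I_k -> ptree X) (I : {set X * X}) l :
  (forall l x y, x != y -> (#|[set i | tree_reach (T i) l x y]| * #|X|.-1 <= k * 4 ^ l)%N) ->
  (forall p, p \in I -> p.1 != p.2) ->
  (forall p q, p \in I -> q \in I -> p != q -> uniq [:: p.1; p.2; q.1; q.2]) ->
  ((\sum_i \sum_(p in I) \sum_(q in I) close_pairs (T i) l p q) * #|X|.-1 <=
   3 * (k * 4 ^ l) * #|I| ^ 2)%N.
Proof.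
move=> few I12 Iu; rewrite exchange_big /=.
under eq_bigr => p _ do rewrite exchange_big /=.
rewrite big_distrl /= expnS expn1 mulnC -mulnA -sum_nat_const; apply: leq_sum => p pI.
rewrite big_distrl /= -sum_nat_const; apply: leq_sum => q qI.
have [->|pq] := eqVneq p q.
  by rewrite big1 // => i _; rewrite /close_pairs eqxx.
have := Iu _ _ pI qI pq; rewrite /= !inE !negb_or => /and4P[/and3P[_ pq1 pq2] _ _ _].
apply: (@leq_trans ((\sum_i (tree_reach (T i) l p.1 p.2 + tree_reach (T i) l p.1 q.1 +
    tree_reach (T i) l p.1 q.2)) * #|X|.-1)%N).
  rewrite leq_mul2r; apply/orP; right; apply: leq_sum => i _; rewrite /close_pairs pq /=.
  by do 3!case: (tree_reach _ _ _ _).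
have cardE x y : (\sum_i tree_reach (T i) l x y = #|[set i | tree_reach (T i) l x y]|)%N.
  by rewrite -sum1_card [RHS]big_mkcond /=; apply: eq_bigr => i _; rewrite inE; case: ifP.
rewrite !big_split /= !cardE.
have := few l _ _ (I12 _ pI); have := few l _ _ pq1; have := few l _ _ pq2.
by move=> h1 h2 h3; rewrite -[3%N]/(1 + 1 + 1)%N !mulnDl !mul1n !leq_add.
Qed.

(* Markov's inequality for the number of close pairs of pairs in a random tree. *)
Lemma card_good_trees (R : realType) (X : finType) (k : nat) (T : 'I_k -> ptree X)
    (I : {set X * X}) (K : nat) (r : R) :
  (0 < #|I|)%N -> 4^-1 <= r -> (2 <= #|X|)%N -> (64 ^ K <= #|X|)%N ->
  (forall l x y, x != y -> (#|[set i | tree_reach (T i) l x y]| * #|X|.-1 <= k * 4 ^ l)%N) ->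
  (forall p, p \in I -> p.1 != p.2) ->
  (forall p q, p \in I -> q \in I -> p != q -> uniq [:: p.1; p.2; q.1; q.2]) ->
  (1 - 6 * r ^+ K) * k%:R <= #|[set i | (\sum_(p in I) \sum_(q in I) close_pairs (T i) K p q)%:R
      <= r ^+ K * #|I|%:R ^+ 2]|%:R.
Proof.
move=> I0 r4 X2 KX few I12 Iu; set good := [set i | _].
have := sum_close_pairs K few I12 Iu.
set B := (X in (X * _ <= _)%N); rewrite -(ler_nat R) !natrM !natrX => le1.
have m0 : 0 < #|I|%:R ^+ 2 :> R by rewrite exprn_gt0 // ltr0n.
have r0 : 0 < r by lra.
have rK : 0 < r ^+ K by rewrite exprn_gt0.
have le2 : (k%:R - #|good|%:R) * (r ^+ K * #|I|%:R ^+ 2) <= B%:R :> R.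
  have -> : k%:R - #|good|%:R = #|~: good|%:R :> R.
    by apply/eqP; rewrite subr_eq addrC -natrD cardsC card_ord.
  rewrite mulr_natl -sumr_const /B natr_sum [leRHS](bigID (mem good)) /=.
  apply: (@le_trans _ _ (\sum_(i in ~: good)
      (\sum_(p in I) \sum_(q in I) close_pairs (T i) K p q)%:R)).
    by apply: ler_sum => i; rewrite !inE -ltNge => /ltW.
  rewrite (eq_bigl (fun i => i \notin good)); last by move=> i; rewrite inE.
  by rewrite lerDr; apply: sumr_ge0.
have X1 : 64 ^+ K <= 2 * (#|X|.-1)%:R :> R.
  rewrite -natrX -natrM ler_nat; apply: leq_trans KX _; lia.
set y := k%:R - #|good|%:R in le2 *.
have y0 : 0 <= y.
  by rewrite subr_ge0 ler_nat; have := max_card good; rewrite card_ord.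
have le3 : y * r ^+ K * (#|X|.-1)%:R <= 3 * (k%:R * 4 ^+ K).
  rewrite -(ler_pM2r m0); apply: le_trans le1.
  have -> : y * r ^+ K * (#|X|.-1)%:R * #|I|%:R ^+ 2 = y * (r ^+ K * #|I|%:R ^+ 2) * (#|X|.-1)%:R.
    by ring.
  by apply: ler_wpM2r.
have le4 : y * r ^+ K * 16 ^+ K <= 6 * k%:R.
  have k4 : 0 < 4 ^+ K :> R by apply: exprn_gt0.
  have e64 : 16 ^+ K * 4 ^+ K = 64 ^+ K :> R by rewrite -exprMn; congr (_ ^+ _); ring.
  rewrite -(ler_pM2r k4) -[leLHS]mulrA e64.
  apply: (@le_trans _ _ (y * r ^+ K * (2 * (#|X|.-1)%:R))).
    by apply: ler_wpM2l => //; apply: mulr_ge0 => //; apply: ltW.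
  lra.
have one : 1 <= 16 ^+ K * r ^+ K * r ^+ K.
  rewrite -!exprMn; apply: exprn_ege1; nra.
have : y <= 6 * k%:R * r ^+ K.
  apply: (@le_trans _ _ (y * r ^+ K * 16 ^+ K * r ^+ K)).
    have -> : y * r ^+ K * 16 ^+ K * r ^+ K = y * (16 ^+ K * r ^+ K * r ^+ K) by ring.
    exact: ler_peMr.
  by apply: ler_wpM2r => //; apply: ltW.
rewrite /y; lra.
Qed.

Local Open Scope classical_set_scope.
Local Open Scope ring_scope.

Lemma cvg_pow_trunc_log (R : realType) (A r : R) : 0 <= r -> r < 1 ->
  (fun n => A * r ^+ trunc_log 64 n) @ \oo --> 0.
Proof.
move=> r0 r1; rewrite -[X in _ --> X](mulr0 A); apply: cvgMr.
have logoo : trunc_log 64 @ \oo --> \oo.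
  move=> S [M _ MS]; exists (64 ^ M)%N => // n /= Mn; apply: MS => /=.
  by rewrite -(@trunc_expnK 64 M) //; apply: leq_trunc_log.
apply: (cvg_comp _ _ logoo (cvg_expr _)); rewrite ger0_norm //.
Qed.

Theorem theorem3p1 (R : realType) (f g : R) (hf : 0 < f) (hg0 : 0 < g) (hg : g < 2^-1) :
  exists (eps delta : nat -> R),
    eps @ \oo --> 0 /\ delta @ \oo --> 0 /\
    forall (n : nat) (X : finType), #|X| = n ->
    forall (T1 : ptree X) (p1 : 'I_(vn T1) -> 'I_(vn T1) -> R),
      is_binary_phylo_tree T1 -> cfn_mech p1 ->
      (forall u w, adj T1 u w -> p1 u w <= g) ->
      exists (k : nat) (T2s : 'I_k -> ptree X),
        [/\ (1 - delta n) * (tree_count n)%:R <= k%:R,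
            (forall i j, ptree_iso (T2s i) (T2s j) -> i = j),
            (forall i, is_binary_phylo_tree (T2s i))
          & (forall i (p2 : 'I_(vn (T2s i)) -> 'I_(vn (T2s i)) -> R),
               cfn_mech p2 -> (forall u w, adj (T2s i) u w -> f <= p2 u w) ->
               2 - eps n <= vardist p1 p2)].
Proof.
have [C CP] := edge_disjoint_short_paths.
pose r : R := Num.max 4^-1 (1 - 2 * f).
have r4 : 4^-1 <= r by rewrite le_max lexx.
have rf : 1 - 2 * f <= r by rewrite le_max lexx orbT.
have r1 : r < 1 by rewrite gt_max; apply/andP; split; lra.
have r0 : 0 <= r by lra.
pose t : R := (1 - 2 * g) ^+ 4.
have t0 : 0 < t by apply: exprn_gt0; lra.
pose eps n : R := 8 / t ^+ 2 * (2 * C%:R + 2) * r ^+ trunc_log 64 n.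
pose delta n : R := 6 * r ^+ trunc_log 64 n.
exists eps, delta; split; [exact: cvg_pow_trunc_log | split; first exact: cvg_pow_trunc_log].
move=> n X Xn T1 p1 b1 m1 g1.
have [d1|d1] := leP 1 (delta n).
  exists 0%N, (fun=> T1); split=> [|[] //|[] //|[] //].
  by rewrite mulr_le0_ge0 ?subr_le0.
have K0 : (0 < trunc_log 64 n)%N.
  by rewrite lt0n; apply: contraTneq d1 => K0; rewrite /delta K0 expr0 -leNgt; lra.
set K := trunc_log 64 n in K0.
have n0 : (0 < n)%N by move: K0; rewrite /K; case: (n).
have Kn : (64 ^ K <= n)%N by apply: trunc_logP.
have n2 : (2 <= n)%N.
  by apply: leq_trans Kn; rewrite -(prednK K0) expnS; have := expn_gt0 64 K.-1; lia.
have [I [F [nC FP I12 Idisj]]] := CP X T1 b1.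
have I0 : (0 < #|I|)%N by rewrite lt0n; apply: contraTneq n0 => I0; move: nC; rewrite I0 Xn; lia.
have Iu p q : p \in I -> q \in I -> p != q -> uniq [:: p.1; p.2; q.1; q.2].
  by move=> pI qI pq; have [] := Idisj p q pI qI pq.
have [k [T [Tk Ti Tb few]]] : exists (k : nat) (T : 'I_k -> ptree X), _ :=
  @representative_family X (leq_trans n2 (eq_leq (esym Xn))).
pose good := [set i | (\sum_(p in I) \sum_(q in I) close_pairs (T i) K p q)%:R
      <= r ^+ K * #|I|%:R ^+ 2 :> R]%SET.
exists #|good|, (fun i => T (enum_val i)); split.
- have : (1 - delta n) * k%:R <= #|good|%:R.
    by apply: card_good_trees => //; rewrite Xn.
  apply: le_trans; apply: ler_wpM2l; first by rewrite subr_ge0 ltW.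
  by rewrite ler_nat -Xn.
- by move=> i j /Ti /enum_val_inj.
- by move=> i; apply: Tb.
move=> i p2 m2 f2; have := enum_valP i; rewrite inE => goodi.
have m0 : 0 < #|I|%:R :> R by rewrite ltr0n.
have var1 := pair_sum_variance b1 m1 (fun p pI => let: And3 a _ b := FP p pI in conj a b)
  (fun p q pI qI pq => (Idisj p q pI qI pq).1).
have er e : e \in edges (T (enum_val i)) -> 1 - 2 * p2 e.1 e.2 <= r.
  by move=> /edges_adj /f2; lra.
have mom2 := pair_sum_sqr_le (Tb (enum_val i)) m2 K r0 (ltW r1) er Iu.
set mu := (\sum_(p in I) _) in var1.
have cmu : t * #|I|%:R <= mu.
  rewrite mulrC mulr_natl -sumr_const; apply: ler_sum => p pI; have [FE F4 _] := FP p pI.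
  apply: prod_theta_ge => //; try lra.
  by move=> e /(subsetP FE) /edges_adj /g1; lra.
have c0 : 0 < t * #|I|%:R by apply: mulr_gt0.
apply: le_trans (second_moment_distance (pair_sum R I) (fun chi => cfn_prob_ge0 chi m1)
  (fun chi => cfn_prob_ge0 chi m2) (cfn_prob_sum1 p1 (binary_tree b1))
  (cfn_prob_sum1 p2 (binary_tree (Tb _))) c0 cmu).
rewrite lerD2l lerN2 /eps -/K.
set q := r ^+ K in goodi mom2 *; set m := #|I|%:R in m0 goodi mom2 var1 *.
have q64 : 1 <= 64 ^+ K * q by rewrite -exprMn; apply: exprn_ege1; lra.
have Cm : 1 <= C%:R * m * q.
  apply: le_trans q64 _; apply: ler_wpM2r; first exact: exprn_ge0.
  rewrite -natrX -natrM ler_nat; apply: leq_trans Kn _; by rewrite -Xn.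
rewrite exprMn invfM mulrA -[leLHS]mulrA -[leRHS]mulrA.
apply: ler_wpM2l; first by apply: divr_ge0 => //; apply: exprn_ge0; apply: ltW.
rewrite mulrC ler_pdivrMr ?exprn_gt0 //.
apply: (@le_trans _ _ (2 * m + 2 * m ^+ 2 * q)); first by lra.
have : m * 1 <= m * (C%:R * m * q) by apply: ler_wpM2l => //; apply: ltW.
by rewrite expr2; lra.
Qed.
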